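(* Let $\mathcal{D}$ be the set of partitions into distinct parts and $\mathcal{U}$ the set of all partitions. As formal power series in $q$, $$\sum_{\pi\in\mathcal{D}} \widetilde{\omega}_2(\pi)\, q^{|\pi|} = \sum_{\pi\in\mathcal{U}} \omega_2'(\pi)\, q^{|\pi|} = \sum_{\pi\in\mathcal{U}} \omega_2^*(\pi)\, q^{|\pi|},$$ where the weights $\widetilde{\omega}_2$, $\omega_2'$, $\omega_2^*$ are as defined in the context.
   Context: A partition $\pi=(\lambda_1,\lambda_2,\dots,\lambda_{\nu(\pi)})$ is a finite non-increasing sequence of positive integers (its parts); $\nu(\pi)$ is the number of parts and $|\pi|$ is the sum of the parts. The empty sequence is the unique partition of $0$, and it belongs to both $\mathcal{D}$ and $\mathcal{U}$. Empty products equal $1$. $f_i(\pi)$ denotes the number of occurrences of $i$ as a part of $\pi$. $\chi(\text{statement})$ equals $1$ if the statement is true and $0$ otherwise. With the convention $\lambda_{\nu(\pi)+1}:=0$, $$\widetilde{\omega}_2(\pi)=\prod_{i=1}^{\nu(\pi)}(2\lambda_i-2\lambda_{i+1}-1).$$ Let $\nu_{de}(\pi)$ be the number of different even parts of $\pi$ (not counting repetitions), and for an integer $n$ let $\mu_{n,o}(\pi)$ be the number of different odd parts of $\pi$ (not counting repetitions) that are $\geq n$. Then $$\omega_2'(\pi)=2^{\nu_{de}(\pi)}\left(1+\sum_{i\geq 0}\chi\big((4i+3)\in\pi\big)\,2^{\mu_{4i+3,o}(\pi)}\right),$$ where $(4i+3)\in\pi$ means that $4i+3$ is a part of $\pi$.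 Finally, $$\omega_2^*(\pi)=\big(1-\chi(f_1(\pi)\geq 2)\big)\prod_{n\geq 2}2^{\chi(f_n(\pi)\geq 1)}+\sum_{j\geq 1}\left(\chi(f_{2j+1}(\pi)\leq 1)\,\chi(f_j(\pi)\geq 2)\,2^{\chi(f_j(\pi)\geq 3)}\prod_{i=1}^{j-1}\chi(f_i(\pi)\geq 3)\,2^{\chi(f_i(\pi)\geq 4)}\prod_{\substack{n>j,\\ n\neq 2j+1}}2^{\chi(f_n(\pi)\geq 1)}\right),$$ where the factor $2^{\chi(f_i(\pi)\geq 4)}$ is inside the product over $i$. For each $\pi$ the sum over $j$ has only finitely many nonzero terms. *)

(* Defs.v *)
From mathcomp Require Import all_boot all_order all_algebra.
Set Implicit Arguments.
Unset Strict Implicit.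
Unset Printing Implicit Defensive.
Import GRing.Theory.
Local Open Scope ring_scope.

(* A partition is a non-increasing list of positive integers: s is the list
   (lambda_1, ..., lambda_nu), so [size s] is nu(pi) and [sumn s] is |pi|. *)
Definition is_partition (s : seq nat) : bool := sorted geq s && (0%N \notin s).

(* The set U of all partitions and the set D of partitions into distinct
   parts. *)
Definition partU : pred (seq nat) := is_partition.
Definition partD : pred (seq nat) := [pred s | is_partition s && uniq s].

(* A partition of n has at most n parts, each at most n, so it occurs among
   the lists of length at most n over {0, ..., n}: see [mem_partitions]. *)
Definition partitions (n : nat) : seq (seq nat) :=
  [seq s <- [seq map val (bseqval t) | t <- enum {: n.-bseq 'I_n.+1}]
     | is_partition s & sumn s == n].

Lemma leq_mem_sumn (s : seq nat) (x : nat) : x \in s -> (x <= sumn s)%N.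
Proof.
elim: s => //= y s IH; rewrite inE => /orP[/eqP -> | /IH le_x].
  exact: leq_addr.
exact: leq_trans le_x (leq_addl _ _).
Qed.

Lemma leq_size_sumn (s : seq nat) : 0%N \notin s -> (size s <= sumn s)%N.
Proof.
elim: s => //= y s IH; rewrite inE negb_or eq_sym -lt0n => /andP[y0 /IH le_s].
by rewrite -add1n leq_add.
Qed.

Lemma mem_partitions (n : nat) (s : seq nat) :
  (s \in partitions n) = is_partition s && (sumn s == n).
Proof.
rewrite mem_filter; apply: andb_idr => /andP[/andP[_ s_gt0] /eqP sum_s].
have sz_s : (size (map (@inord n) s) <= n)%N.
  by rewrite size_map -[leqRHS]sum_s leq_size_sumn.
apply/mapP; exists (Bseq sz_s); first by rewrite mem_enum.
rewrite /= -map_comp -[LHS]map_id; apply/eq_in_map => x s_x /=.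
by rewrite inordK // ltnS -[leqRHS]sum_s leq_mem_sumn.
Qed.

Lemma partitions_uniq (n : nat) : uniq (partitions n).
Proof.
rewrite filter_uniq // map_inj_uniq ?enum_uniq // => t u.
by move/(inj_map val_inj)/val_inj.
Qed.

(* A formal power series over the integers is its sequence of coefficients;
   [weighted_gf P w] is the sum over the partitions pi in P of w(pi) q^|pi|. *)
Definition fps := nat -> int.

Definition weighted_gf (P : pred (seq nat)) (w : seq nat -> int) : fps :=
  fun n => \sum_(s <- partitions n | P s) w s.

Definition chi (b : bool) : nat := b.

(* f_i(pi) *)
Definition freq (i : nat) (s : seq nat) : nat := count_mem i s.

(* The default value of [nth] is the convention lambda_(nu+1) = 0. *)
Definition omega2_tilde (s : seq nat) : int :=
  \prod_(i < size s) (2 * (nth 0%N s i)%:Z - 2 * (nth 0%N s i.+1)%:Z - 1).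

Definition nu_de (s : seq nat) : nat := count (fun x => ~~ odd x) (undup s).

Definition mu_o (n : nat) (s : seq nat) : nat :=
  count (fun x => odd x && (n <= x)%N) (undup s).

(* In the next two weights the index sets are infinite in the source.  They
   are cut off at a bound N; any N >= |pi| gives the same value, see
   [omega2_prime_uptoE] and [omega2_star_uptoE]. *)
Definition omega2_prime_upto (N : nat) (s : seq nat) : int :=
  2 ^+ nu_de s *
  (1 + \sum_(0 <= i < N.+1)
         (chi (4 * i + 3 \in s)%N)%:Z * 2 ^+ mu_o (4 * i + 3) s).

Definition omega2_prime (s : seq nat) : int := omega2_prime_upto (sumn s) s.

Definition omega2_star_upto (N : nat) (s : seq nat) : int :=
  (1 - (chi (2 <= freq 1 s)%N)%:Z)
    * \prod_(2 <= n < N.+1) 2 ^+ chi (1 <= freq n s)%N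
  + \sum_(1 <= j < N.+1)
      ((chi (freq (2 * j + 1) s <= 1)%N)%:Z
       * (chi (2 <= freq j s)%N)%:Z
       * 2 ^+ chi (3 <= freq j s)%N
       * (\prod_(1 <= i < j)
            ((chi (3 <= freq i s)%N)%:Z * 2 ^+ chi (4 <= freq i s)%N))
       * (\prod_(j.+1 <= n < N.+1 | n != (2 * j + 1)%N)
            2 ^+ chi (1 <= freq n s)%N)).

Definition omega2_star (s : seq nat) : int := omega2_star_upto (sumn s) s.

Lemma freq_gt_sumn (s : seq nat) (n : nat) : (sumn s < n)%N -> freq n s = 0%N.
Proof.
move=> lt_n; apply/count_memPn/negP => /leq_mem_sumn.
by rewrite leqNgt lt_n.
Qed.

Lemma omega2_prime_uptoE (s : seq nat) (N : nat) :
  (sumn s <= N)%N -> omega2_prime_upto N s = omega2_prime s.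
Proof.
move=> le_N; rewrite /omega2_prime /omega2_prime_upto; congr (_ * (_ + _)).
rewrite (big_cat_nat (n := (sumn s).+1)) //= [X in _ + X]big_nat.
rewrite [X in _ + X]big1 ?addr0 // => i /andP[lt_i _].
suff /negPf-> : (4 * i + 3)%N \notin s by rewrite mul0r.
apply/negP => /leq_mem_sumn; apply/negP; rewrite -ltnNge.
by apply: leq_trans lt_i _; rewrite mulSn -addnA leq_addr.
Qed.

Lemma omega2_star_uptoE (s : seq nat) (N : nat) :
  (sumn s <= N)%N -> omega2_star_upto N s = omega2_star s.
Proof.
move=> le_N; rewrite /omega2_star /omega2_star_upto.
have prodE (P : pred nat) (m : nat) : (m <= (sumn s).+1)%N ->
    \prod_(m <= n < N.+1 | P n) 2 ^+ chi (1 <= freq n s)%N =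
    \prod_(m <= n < (sumn s).+1 | P n) (2 : int) ^+ chi (1 <= freq n s)%N.
  move=> le_m; rewrite (big_cat_nat le_m) //= [X in _ * X]big_nat_cond.
  by rewrite [X in _ * X]big1 ?mulr1 // => n /andP[/andP[/freq_gt_sumn -> _] _].
congr (_ * _ + _).
  case: (ltnP (sumn s) 1) => [|s_gt0]; last exact: prodE.
  rewrite ltnS leqn0 => /eqP s0; rewrite s0 [RHS]big_geq // big_nat big1 // => n.
  by case/andP=> n_gt1 _; rewrite freq_gt_sumn // s0 ltnW.
rewrite (big_cat_nat (n := (sumn s).+1)) //= [X in _ + X]big_nat.
rewrite [X in _ + X]big1 => [|j /andP[/freq_gt_sumn -> _]]; last first.
  by rewrite /= mulr0 !mul0r.
rewrite addr0; apply: eq_big_nat => j /andP[_ lt_j].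
by congr (_ * _); apply: prodE.
Qed.

(* Main.v *)
Require Import Defs.
From mathcomp Require Import all_boot all_order all_algebra.
From mathcomp Require Import zify ring.
Set Implicit Arguments.
Unset Strict Implicit.
Unset Printing Implicit Defensive.
Import GRing.Theory.
Local Open Scope ring_scope.

(** A partition into [n] distinct parts is determined by its successive
differences and an arbitrary partition by its frequencies, so the three
generating functions are

  [sum_n q^(n(n+1)/2) (-q)_n / (q)_n^2],
  [(-q^2;q^2)_oo / (q)_oo * (1 + 2 sum_i q^(4i+3) (-q^(4i+5);q^2)_oo)],
  [(-q)_oo / (q)_oo * theta], with [theta = sum_j q^(j(3j+1)/2) (1 - q^(2j+1))].

The first equals the third by Bailey's lemma for the pair expressing
[1/(q)_n^2].  For the second, [theta = sum_n (-1)^n q^(n(n+1)/2) / (-q)_n]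
(Rogers-Fine); pairing consecutive terms gives a series in [1/(-q)_(2i+2)],
which is converted into one in [1/(-q;q^2)_k].  Every step is a first-order
recurrence with a telescoping certificate.

Coefficients up to [N] are computed in a commutative ring with [q^(N+1) = 0],
namely [Z[X]/(X^(N+1))], where all sums and products are finite and [1 - q^i]
is invertible. *)

(** * Telescoping sums and triangular numbers *)

Lemma sumr_telescope (V : zmodType) (a w : nat -> V) (n : nat) :
  (forall m, a m = w m - w m.+1) -> \sum_(0 <= m < n) a m = w 0%N - w n.
Proof.
move=> aE; elim: n => [|n IHn]; first by rewrite big_geq ?subrr.
by rewrite big_nat_recr //= IHn aE addrA subrK.
Qed.

Lemma sumr_pairs (V : zmodType) (a : nat -> V) (n : nat) :
  \sum_(0 <= m < n.*2) a m = \sum_(0 <= i < n) (a i.*2 + a i.*2.+1).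
Proof.
elim: n => [|n IHn]; first by rewrite !big_geq.
by rewrite doubleS !big_nat_recr //= IHn addrA.
Qed.

Definition tri (n : nat) : nat := 'C(n.+1, 2).

Lemma triS (n : nat) : tri n.+1 = (tri n + n.+1)%N.
Proof. by rewrite /tri binS bin1. Qed.

Lemma triD (m n : nat) : tri (m + n) = (tri m + tri n + m * n)%N.
Proof. by elim: n => [|n IHn]; rewrite ?addnS ?triS ?IHn ?addn0; lia. Qed.

Lemma tri_double (n : nat) : (tri n).*2 = (n * n.+1)%N.
Proof. by elim: n => // n IHn; rewrite triS doubleD IHn; lia. Qed.

Lemma leq_tri (n : nat) : (n <= tri n)%N.
Proof. by case: n => // n; rewrite triS leq_addl. Qed.

(** * Identities of q-series in a ring where [q ^+ N.+1 = 0] *)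

Section Nilpotent.
Variables (R : comNzRingType) (N : nat) (q : R).
Hypothesis q_nil : q ^+ N.+1 = 0.

Lemma qX_eq0 (m : nat) : (N < m)%N -> q ^+ m = 0.
Proof. by move=> /subnK <-; rewrite exprD q_nil mulr0. Qed.

Lemma qXX_eq0 (i k : nat) : (0 < i)%N -> (N < k)%N -> (q ^+ i) ^+ k = 0.
Proof. by move=> i0 Nk; rewrite -exprM qX_eq0 // (leq_trans Nk) // leq_pmull. Qed.

Definition geo (x : R) : R := \sum_(0 <= k < N.+1) x ^+ k.

Lemma geoV (x : R) : x ^+ N.+1 = 0 -> (1 - x) * geo x = 1.
Proof.
move=> x0; rewrite -[RHS]subr0 -x0 mulr_sumr.
rewrite -[X in X - _](expr0 x); apply: sumr_telescope => k.
by rewrite mulrBl mul1r exprS.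
Qed.

(* [1/(q)_n], [(-q)_n], [1/(-q)_n], [(-q;q^2)_n] and [1/(-q;q^2)_n]. *)
Definition qpochV (n : nat) : R := \prod_(i < n) geo (q ^+ i.+1).
Definition qpochp (n : nat) : R := \prod_(i < n) (1 + q ^+ i.+1).
Definition qpochpV (n : nat) : R := \prod_(i < n) geo (- q ^+ i.+1).
Definition qpocho (n : nat) : R := \prod_(i < n) (1 + q ^+ i.*2.+1).
Definition qpochoV (n : nat) : R := \prod_(i < n) geo (- q ^+ i.*2.+1).

Lemma geoqV (i : nat) : (0 < i)%N -> (1 - q ^+ i) * geo (q ^+ i) = 1.
Proof. by move=> i0; rewrite geoV // qXX_eq0. Qed.

Lemma geoqpV (i : nat) : (0 < i)%N -> (1 + q ^+ i) * geo (- q ^+ i) = 1.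
Proof.
move=> i0; rewrite -[X in 1 + X]opprK geoV //.
by rewrite exprNn qXX_eq0 // mulr0.
Qed.

Lemma qpochpS n : qpochp n.+1 = qpochp n * (1 + q ^+ n.+1).
Proof. by rewrite /qpochp big_ord_recr. Qed.

Lemma qpochVS n : qpochV n = qpochV n.+1 * (1 - q ^+ n.+1).
Proof. by rewrite /qpochV big_ord_recr /= -mulrA mulrC [_ * (1 - _)]mulrC geoqV ?mul1r. Qed.

Lemma qpochpVS n : qpochpV n = qpochpV n.+1 * (1 + q ^+ n.+1).
Proof. by rewrite /qpochpV big_ord_recr /= -mulrA [_ * (1 + _)]mulrC geoqpV ?mulr1. Qed.

Lemma qpochoVS n : qpochoV n = qpochoV n.+1 * (1 + q ^+ n.*2.+1).
Proof. by rewrite /qpochoV big_ord_recr /= -mulrA [_ * (1 + _)]mulrC geoqpV ?mulr1. Qed.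

(** Factors of index above [N] equal 1, so the value at [N] stands for the infinite product. *)
Lemma qpochVE n : (N <= n)%N -> qpochV n = qpochV N.
Proof.
move=> /subnK <-; elim: (n - N)%N => // k <-.
by rewrite [RHS]qpochVS addSn qX_eq0 ?subr0 ?mulr1 // ltnS leq_addl.
Qed.

Lemma qpochpE n : (N <= n)%N -> qpochp n = qpochp N.
Proof.
move=> /subnK <-; elim: (n - N)%N => // k <-.
by rewrite addSn qpochpS qX_eq0 ?addr0 ?mulr1 // ltnS leq_addl.
Qed.

Lemma qpochoVE n : (N <= n)%N -> qpochoV n = qpochoV N.
Proof.
move=> /subnK <-; elim: (n - N)%N => // k <-.
by rewrite [RHS]qpochoVS addSn qX_eq0 ?addr0 ?mulr1 //; lia.
Qed.

Lemma qpochpK n : qpochp n * qpochpV n = 1.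
Proof.
by rewrite /qpochp /qpochpV -big_split big1 //= => i _; apply: geoqpV.
Qed.

Lemma qpochoK n : qpocho n * qpochoV n = 1.
Proof.
by rewrite /qpocho /qpochoV -big_split big1 //= => i _; apply: geoqpV.
Qed.

(* Only [s = r] is needed; the free [s] allows iterating [s -> s + 1] until all
terms but [m = 0] vanish (a limit case of the q-Gauss sum). *)
Definition gauss_sum (r s : nat) : R :=
  \sum_(0 <= m < N.+1) q ^+ (tri m + s * m) * qpochp (r + m)
                  * qpochV m * qpochV (m + s + r).+1.

Lemma gauss_sumS (r s : nat) :
  gauss_sum r s = (1 + q ^+ s.+1) * gauss_sum r s.+1.
Proof.
apply/subr0_eq; rewrite mulr_sumr -sumrB.
(* The factor [1 - q ^+ m] makes [w 0] vanish and nilpotency kills [w N.+1], so the difference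
   telescopes to 0. *)
pose w m := q ^+ (tri m + s * m) * qpochp (r + m) * qpochV m
            * (1 - q ^+ m) * qpochV (m + s + r).+1.
rewrite (@sumr_telescope _ _ w) => [|m].
  rewrite /w expr0 subrr mulr0 mul0r (@qX_eq0 (tri _ + _)) ?mul0r ?subr0 //.
  by rewrite ltn_addr ?leq_tri.
rewrite /w (addnS r) qpochpS (addnS m) !addSn [in qpochV (m + s + r).+1]qpochVS.
rewrite [in qpochV m]qpochVS.
have -> : (tri m.+1 + s * m.+1 = tri m + s * m + (m + s).+1)%N.
  by rewrite triS; lia.
have -> : (tri m + s.+1 * m = tri m + s * m + m)%N by lia.
move: (tri m) => t.
rewrite ?exprD ?exprS ?exprD.
ring.
Qed.

Lemma qpochp_gauss_sum (r s k : nat) :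
  qpochp s * gauss_sum r s = qpochp (s + k) * gauss_sum r (s + k).
Proof.
elim: k => [|k IHk]; first by rewrite addn0.
by rewrite IHk gauss_sumS mulrA -qpochpS addnS.
Qed.

Lemma gauss_sum_large (r s : nat) : (N <= s)%N ->
  gauss_sum r s = qpochp r * qpochV N.
Proof.
move=> Ns; rewrite /gauss_sum big_nat_recl // big1_seq ?addr0 => [|m _].
  rewrite muln0 expr0 mul1r addn0 /qpochV big_ord0 mulr1 -!/(qpochV _).
  by rewrite [in LHS]qpochVE //; lia.
rewrite (@qX_eq0 (_ + _)) ?mul0r // mulnS triS; lia.
Qed.

(** Shifting [s] from [r] to [r + N] leaves the single term [m = 0]; the factor [qpochp r] then
    cancels. *)
Lemma gauss_sum_diag (r : nat) : gauss_sum r r = qpochp N * qpochV N.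
Proof.
have := qpochp_gauss_sum r r N; rewrite (@gauss_sum_large r (r + N)) ?leq_addl //.
rewrite (@qpochpE (r + N)) ?leq_addl // mulrCA => /(congr1 ( *%R (qpochpV r))).
by rewrite !mulrA ![qpochpV r * _]mulrC !qpochpK !mul1r.
Qed.

(* [1/(q)_n^2 = sum_r q^(r^2) (1 - q^(2r+1)) / ((q)_(n-r) (q)_(n+r+1))]
telescopes in [r]; this is the [r]-th tail of the double sum obtained by
inserting it, with [n = r + m]. *)
Definition bailey_sum (r : nat) : R :=
  \sum_(0 <= m < N.+1) q ^+ (tri (r + m) + r * r) * qpochp (r + m)
                  * qpochV m * qpochV (m + r.*2).

Lemma bailey_sumS (r : nat) :
  bailey_sum r - bailey_sum r.+1
  = q ^+ (r * r + tri r) * (1 - q ^+ r.*2.+1) * (qpochp N * qpochV N).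
Proof.
(* [gauss_sum_diag] read backwards turns the closed product into a sum over [m]. *)
have -> : q ^+ (r * r + tri r) * (1 - q ^+ r.*2.+1) * (qpochp N * qpochV N) =
    \sum_(0 <= m < N.+1) q ^+ (tri (r + m) + r * r) * (1 - q ^+ r.*2.+1)
      * qpochp (r + m) * qpochV m * qpochV (m + r.*2).+1.
  rewrite -(gauss_sum_diag r) mulr_sumr; apply: eq_bigr => m _.
  rewrite triD -addnA addnn !exprD; ring.
(* For fixed n = r + m, term m at [r] faces term m - 1 at [r.+1], and the step rests on (1 -
   q^(m+2r+1)) - q^(2r+1) (1 - q^m) = 1 - q^(2r+1). The last term at [r.+1] vanishes. *)
rewrite {2}/bailey_sum big_nat_recr //= (@qX_eq0 (_ + _)) ?mul0r ?addr0.
  rewrite /bailey_sum !(big_nat_recl N) //= -addrA -sumrB; congr (_ + _).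
    by rewrite add0n [in qpochV (_.*2)]qpochVS; ring.
  apply: eq_bigr => m _.
  have -> : (r.+1 * r.+1 = r * r + r.*2.+1)%N by lia.
  rewrite (addSn r) (addnS r m) (addSn m) doubleS !(addnS m) !addnS.
  rewrite [in qpochV (m + r.*2).+1]qpochVS [in qpochV m]qpochVS.
  move: (tri _) (r * r)%N => t u.
  rewrite ?exprD ?exprS ?exprD -!addnn ?exprD; ring.
by rewrite triD; have := leq_tri N; have := leq_tri r.+1; lia.
Qed.

(** The tail at 0 is the left side and the tail at [N.+1] vanishes, so the differences [bailey_sumS]
    add up to it. *)
Lemma bailey_theta :
  \sum_(0 <= n < N.+1) q ^+ tri n * qpochp n * qpochV n * qpochV n
  = qpochp N * qpochV N *
    \sum_(0 <= r < N.+1) q ^+ (r * r + tri r) * (1 - q ^+ r.*2.+1).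
Proof.
transitivity (bailey_sum 0).
  by apply: eq_bigr => m _; rewrite add0n !addn0.
transitivity (bailey_sum 0 - bailey_sum N.+1).
  rewrite [X in _ - X]big1_seq ?subr0 // => m _.
  by rewrite (@qX_eq0 (_ + _)) ?mul0r //; have := leq_tri (N.+1 + m); lia.
rewrite mulr_sumr -(@sumr_telescope _ _ _ _ (fun r => erefl)).
by apply: eq_bigr => r _; rewrite bailey_sumS mulrC.
Qed.

(* [sum_(n < c) (-1)^n q^(n(n+1)/2 + 2jn) / (-q^(j+1);q)_n] *)
Definition fine_sum (c j : nat) : R :=
  \sum_(0 <= n < c) (-1) ^+ n * q ^+ (tri n + (j * n).*2)
                    * (qpochp j * qpochpV (j + n)).

Lemma fine_sumS (c j : nat) : (N < c)%N ->
  fine_sum c j = 1 - q ^+ j.*2.+1 + q ^+ (3 * j).+2 * fine_sum c j.+1.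
Proof.
move=> Nc; apply/eqP; rewrite -subr_eq; apply/eqP.
(* [w 0] is the inhomogeneous term [1 - q ^+ j.*2.+1]; [w c] vanishes because [c] exceeds [N]. *)
pose w n := (-1) ^+ n * q ^+ (tri n + (j * n).*2) * (qpochp j * qpochpV (j + n))
            * (1 - q ^+ (n + j.*2).+1).
rewrite mulr_sumr -sumrB (@sumr_telescope _ _ w) => [|n].
  rewrite /w muln0 addn0 qpochpK add0n {1}/tri /= expr0 !mul1r.
  by rewrite (@qX_eq0 (tri _ + _)) ?mulr0 ?mul0r ?subr0 //; have := leq_tri c; lia.
rewrite /w qpochpS addnS addSn [in qpochpV (j + n)]qpochpVS.
have -> : (tri n.+1 + (j * n.+1).*2 = tri n + (j * n).*2 + (j.*2 + n).+1)%N.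
  by rewrite triS; lia.
have -> : (tri n + (j.+1 * n).*2 = tri n + (j * n).*2 + n.*2)%N by lia.
move: (tri n) ((j * n).*2) => t u.
rewrite ?exprD -!addnn ?exprS ?exprD; ring.
Qed.

(** Multiplying [fine_sumS] by q^(r^2 + r(r+1)/2), whose exponent grows by 3r + 2, makes it
    telescope. *)
Lemma fine_theta (c : nat) : (N < c)%N ->
  \sum_(0 <= r < N.+1) q ^+ (r * r + tri r) * (1 - q ^+ r.*2.+1)
  = fine_sum c 0.
Proof.
move=> Nc; pose y r := q ^+ (r * r + tri r) * fine_sum c r.
rewrite (@sumr_telescope _ _ y) => [|r].
  by rewrite /y mul1r (@qX_eq0 (_ + _)) ?mul0r ?subr0 // ltn_addr // leq_pmulr.
rewrite /y (@fine_sumS c r) //.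
have -> : (r.+1 * r.+1 + tri r.+1 = r * r + tri r + (3 * r).+2)%N.
  by rewrite triS; lia.
by rewrite (exprD _ (_ + _)); ring.
Qed.

(* [sum_(k < c) (-1)^k q^(2k(j+1)) / (-q^(2j+1);q^2)_(k+1)] *)
Definition odd_sum (c j : nat) : R :=
  \sum_(0 <= k < c) (-1) ^+ k * q ^+ (k * j.+1).*2
                    * (qpocho j * qpochoV (j + k).+1).

Lemma odd_sumS (c j : nat) : (N < c)%N ->
  (1 + q ^+ j.*2.+1) * (1 + q ^+ j.*2.+2) * odd_sum c j
  = 1 + q ^+ (4 * j + 5) * odd_sum c j.+1.
Proof.
move=> Nc; apply/eqP; rewrite -subr_eq; apply/eqP.
(* The last factor cancels against [qpochoV j.+1], so [w 0 = 1]; the power of [q] in [w c] is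
   zero. *)
pose w k := (-1) ^+ k * q ^+ (k * j.+1).*2 * (qpocho j * qpochoV (j + k).+1)
            * (1 + q ^+ j.*2.+1).
rewrite !mulr_sumr -sumrB (@sumr_telescope _ _ w) => [|k].
  rewrite /w (@qX_eq0 (c * _).*2) ?mulr0 ?mul0r ?subr0; last by lia.
  by rewrite mul0n addn0 double0 !expr0 !mul1r -mulrA -qpochoVS qpochoK.
rewrite /w {2}/qpocho big_ord_recr /= -/(qpocho j) (addnS j) addSn.
rewrite [in qpochoV (j + k).+1]qpochoVS.
have -> : ((k.+1 * j.+1).*2 = (k * j.+1).*2 + j.+1.*2)%N by lia.
have -> : ((k * j.+2).*2 = (k * j.+1).*2 + k.*2)%N by lia.
have -> : (4 * j + 5 = j.*2 + j.*2 + 5)%N by lia.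
move: ((k * j.+1).*2) => u.
rewrite ?doubleS ?doubleD -?addnn ?exprS ?exprD ?exprS ?exprD; ring.
Qed.

(** Dividing [odd_sumS] by (-q)_(2j+2) and multiplying by q^(2j^2+3j), whose exponent grows by 4j +
    5, makes it telescope. *)
Lemma sum_even_qpochpV (c : nat) : (N < c)%N ->
  \sum_(0 <= i < N.+1) q ^+ (2 * i * i + 3 * i) * qpochpV (i.*2.+2)
  = odd_sum c 0.
Proof.
move=> Nc; pose y j := q ^+ (2 * j * j + 3 * j) * qpochpV j.*2 * odd_sum c j.
rewrite (@sumr_telescope _ _ y) => [|j].
  rewrite /y (@qX_eq0 (_ + 3 * N.+1)) ?mul0r ?subr0; last by rewrite ltn_addl //; lia.
  by rewrite !muln0 mul1r /qpochpV big_ord0 mul1r.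
rewrite /y.
have -> : (2 * j.+1 * j.+1 + 3 * j.+1 = 2 * j * j + 3 * j + (4 * j + 5))%N by lia.
rewrite doubleS [in qpochpV j.*2]qpochpVS [in qpochpV j.*2.+1]qpochpVS.
have := odd_sumS j Nc; rewrite (exprD _ _ (_ + 5)) => E.
set a := qpochpV _; set b := q ^+ _.
transitivity (b * a * ((1 + q ^+ j.*2.+1) * (1 + q ^+ j.*2.+2) * odd_sum c j)
   - b * q ^+ (4 * j + 5) * a * odd_sum c j.+1).
  rewrite E; ring.
ring.
Qed.

(** Multiplied by (-q)_oo / (q)_oo, the right side becomes the second generating function:
    1/(-q;q^2)_(2i+2) cancels the odd factors up to 1 + q^(4i+3). *)
Lemma theta_odd :
  \sum_(0 <= r < N.+1) q ^+ (r * r + tri r) * (1 - q ^+ r.*2.+1)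
  = qpochoV N + \sum_(0 <= i < N.+1) 2 * q ^+ (4 * i + 3) * qpochoV i.*2.+2.
Proof.
(* This cutoff leaves exactly N + 1 pairs after the term n = 0. *)
rewrite (@fine_theta N.+1.*2.+1); last by lia.
(* Terms 2i+1 and 2i+2 combine to -q^(2i^2+3i+1) / (-q)_(2i+2), since (1 + q^(2i+2)) - q^(2i+2) =
   1. *)
have -> : fine_sum N.+1.*2.+1 0 = 1 - q * odd_sum N.+1.*2 0.
  rewrite /fine_sum big_nat_recl // -(@sum_even_qpochpV N.+1.*2); last by lia.
  rewrite expr0 mul1r /tri /= expr0 mul1r qpochpK; congr (_ + _).
  rewrite (@sumr_pairs _ (fun n => (-1) ^+ n.+1 * q ^+ (tri n.+1 + (0 * n.+1).*2)
            * (qpochp 0 * qpochpV (0 + n.+1)))) mulr_sumr -sumrN.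
  apply: eq_bigr => i _.
  rewrite !mul0n !addn0 /qpochp big_ord0 mul1r !add0n.
  rewrite [in qpochpV i.*2.+1]qpochpVS.
  have E : tri i.*2.+1 = (1 + (2 * i * i + 3 * i))%N.
    by have := tri_double i.*2.+1; lia.
  rewrite [tri i.*2.+2]triS E (exprD _ _ i.*2.+2) !exprD -addnn !exprS.
  rewrite !exprD; have := sqrr_sign R i; rewrite expr2 => ->; ring.
(* With a_k = q^(2k+1) / (-q;q^2)_(k+1), both sides are now sums of a_k. The alternating sum is the
   full sum minus twice the terms a_(2i+1) = q^(4i+3) / (-q;q^2)_(2i+2). *)
have -> : qpochoV N = 1 - \sum_(0 <= k < N.+1.*2) q ^+ k.*2.+1 * qpochoV k.+1.
  rewrite (@sumr_telescope _ _ qpochoV) => [|k].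
    by rewrite {2}/qpochoV big_ord0 opprB addrCA subrr addr0 qpochoVE //; lia.
  by rewrite [in qpochoV k]qpochoVS; ring.
rewrite /odd_sum (@sumr_pairs _ (fun k => q ^+ k.*2.+1 * qpochoV k.+1)).
rewrite (@sumr_pairs _ (fun k => (-1) ^+ k * q ^+ (k * 1).*2
                    * (qpocho 0 * qpochoV (0 + k).+1))).
rewrite -addrA; congr (_ + _); rewrite mulr_sumr -!sumrN -big_split.
apply: eq_bigr => i _ /=.
rewrite /qpocho big_ord0 mul1r !add0n !muln1.
have -> : (4 * i + 3 = i.*2.*2 + 3)%N by lia.
rewrite !doubleS -!addnn !exprS ?exprD !exprS ?exprD.
have := sqrr_sign R i; rewrite expr2 => ->; ring.
Qed.

End Nilpotent.

(** * Partitions as frequency vectors and as difference vectors *)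

(** Injectivity is asked only on the partitions summed over: the codes used below pass through
    [inord], which is faithful only for entries at most [N]. *)
Lemma sum_partitions_reindex (V : nmodType) (T : finType) (n : nat)
    (P : pred (seq nat)) (Q : pred T) (f : seq nat -> T) (F : T -> V) :
  let A := [pred s | [&& is_partition s, sumn s == n & P s]] in
  {in A, forall s, Q (f s)} -> {in A &, injective f} ->
  (forall t, Q t -> exists2 s, s \in A & f s = t) ->
  \sum_(s <- partitions n | P s) F (f s) = \sum_(t | Q t) F t.
Proof.
move=> A fQ f_inj f_surj.
have memA s : (s \in [seq s <- partitions n | P s]) = (s \in A).
  by rewrite mem_filter mem_partitions andbC -andbA.
rewrite -big_filter -(big_map f xpredT F).
transitivity (\sum_(t <- enum Q) F t); last by rewrite big_enum.
apply: perm_big; apply: uniq_perm; rewrite ?enum_uniq //.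
  rewrite map_inj_in_uniq ?(filter_uniq _ (partitions_uniq n)) // => s t.
  by rewrite !memA; apply: f_inj.
move=> t; rewrite mem_enum; apply/mapP/idP => [[s]|/f_surj[s As <-]].
  by rewrite memA => As ->; apply: fQ.
by exists s; rewrite ?memA.
Qed.

Lemma leq_freq_sumn (i : nat) (s : seq nat) : (freq i.+1 s <= sumn s)%N.
Proof. by elim: s => //= x s; rewrite /freq /=; lia. Qed.

Lemma freq0_partition (s : seq nat) : is_partition s -> freq 0 s = 0%N.
Proof. by case/andP=> _ /count_memPn. Qed.

Lemma partition_inj (s t : seq nat) : is_partition s -> is_partition t ->
  freq^~ s =1 freq^~ t -> s = t.
Proof.
case/andP=> s_sorted _ /andP[t_sorted _] eq_st.
have geq_trans : transitive geq by move=> y x z /=; lia.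
have geq_anti : antisymmetric geq by move=> x y /=; lia.
apply: (sorted_eq geq_trans geq_anti) => //.
apply/allP => x _ /=; apply/eqP; exact: eq_st.
Qed.

Lemma sumn_freq (M : nat) (s : seq nat) : (sumn s <= M)%N ->
  sumn s = (\sum_(i < M) i.+1 * freq i.+1 s)%N.
Proof.
elim: s => [_|x s IHs] /=; first by rewrite big1 // => i _; rewrite muln0.
move=> le_M; rewrite {1}IHs; last by rewrite (leq_trans _ le_M) ?leq_addl.
rewrite /freq /=; under [RHS]eq_bigr do rewrite mulnDr.
rewrite [RHS]big_split /=; congr addn.
case: x le_M => [|x] le_M; first by rewrite big1 // => i _; rewrite muln0.
have lt_x : (x < M)%N by lia.
rewrite (bigD1 (Ordinal lt_x)) //= eqxx muln1 big1 ?addn0 // => i.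
by rewrite -val_eqE /= eqSS eq_sym => /negPf->; rewrite muln0.
Qed.

Definition of_freqs (M N : nat) (t : {ffun 'I_M -> 'I_N.+1}) : seq nat :=
  sort geq (flatten [seq nseq (t i) i.+1 | i <- enum 'I_M]).

Lemma freq_of_freqs (M N : nat) (t : {ffun 'I_M -> 'I_N.+1}) (i : 'I_M) :
  freq i.+1 (of_freqs t) = t i.
Proof.
rewrite /freq /of_freqs; have /permP-> := permEl (perm_sort geq
  (flatten [seq nseq (t i) i.+1 | i <- enum 'I_M])).
rewrite count_flatten sumnE -map_comp big_map big_enum /= (bigD1 i) //=.
rewrite count_nseq /= eqxx mul1n big1 ?addn0 // => j.
by rewrite count_nseq /= eqSS -val_eqE => /negPf->.
Qed.

Lemma of_freqs_partition (M N : nat) (t : {ffun 'I_M -> 'I_N.+1}) :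
  is_partition (of_freqs t).
Proof.
rewrite /is_partition sort_sorted; last by move=> x y /=; lia.
rewrite mem_sort; apply/negP => /flattenP[_ /mapP[i _ ->]].
by rewrite mem_nseq andbC.
Qed.

Lemma sumn_of_freqs (M N : nat) (t : {ffun 'I_M -> 'I_N.+1}) :
  sumn (of_freqs t) = (\sum_(i < M) i.+1 * t i)%N.
Proof.
rewrite /of_freqs (perm_sumn (permEl (perm_sort _ _))) sumn_flatten sumnE.
rewrite -map_comp big_map big_enum /=; apply: eq_bigr => i _.
by rewrite sumn_nseq.
Qed.

(** [M] bounds the part sizes and [N] the multiplicities; they are kept apart because the weights
    single out parts such as 2j+1 and 4i+3, which may exceed [N]. *)
Lemma sum_partitions_freq (V : nmodType) (M N n : nat)
    (F : {ffun 'I_M -> 'I_N.+1} -> V) : (n <= N)%N -> (N <= M)%N ->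
  \sum_(s <- partitions n) F [ffun i : 'I_M => inord (freq i.+1 s)]
  = \sum_(t : {ffun 'I_M -> 'I_N.+1} | (\sum_(i < M) i.+1 * t i == n)%N) F t.
Proof.
move=> nN NM.
have freqK s i : sumn s = n -> (inord (freq i.+1 s) : 'I_N.+1) = freq i.+1 s :> nat.
  by move=> s_n; rewrite inordK // ltnS (leq_trans (leq_freq_sumn _ _)) ?s_n.
apply: (@sum_partitions_reindex _ _ _ xpredT) => [s|s t|t /eqP t_n].
- case/and3P=> _ /eqP s_n _; rewrite -[X in _ == X]s_n (@sumn_freq M) ?s_n ?(leq_trans nN) //.
  by apply/eqP; apply: eq_bigr => i _; rewrite ffunE freqK.
- case/and3P=> s_part /eqP s_n _ /and3P[t_part /eqP t_n _] /ffunP eq_st.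
  apply: partition_inj => // -[|i]; first by rewrite !freq0_partition.
  case: (ltnP i M) => [lt_i|le_i]; last first.
    by rewrite !freq_gt_sumn // ?s_n ?t_n ltnS ?(leq_trans nN) ?(leq_trans NM).
  by have := congr1 val (eq_st (Ordinal lt_i)); rewrite !ffunE /= !freqK.
- have sumE : sumn (of_freqs t) = n by rewrite sumn_of_freqs.
  exists (of_freqs t); first by rewrite inE of_freqs_partition sumE eqxx.
  by apply/ffunP => i; apply/val_inj; rewrite ffunE /= freqK // freq_of_freqs.
Qed.

(** * Difference vectors of partitions into distinct parts *)

Definition gaps (s : seq nat) (i : nat) : nat := (nth 0 s i - nth 0 s i.+1)%N.

Lemma sum_gaps (s : seq nat) (i : nat) : sorted geq s ->
  (\sum_(0 <= j < size s | i <= j) gaps s j = nth 0 s i)%N.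
Proof.
elim: s i => [|x s IHs] i s_sorted; first by rewrite big_geq // nth_nil.
have {}IHs := fun i => IHs i (path_sorted s_sorted).
rewrite big_mkcond big_nat_recl //= -big_mkcond /=.
case: i => [|i]; last by rewrite add0n IHs.
have := IHs 0%N; under eq_bigl do rewrite leq0n; move=> ->; rewrite /gaps /=.
by apply: subnK; case: s s_sorted {IHs} => //= y s /andP[].
Qed.

(** The gap at position j is contained in each of the first j + 1 parts. *)
Lemma sumn_gaps (s : seq nat) : sorted geq s ->
  sumn s = (\sum_(0 <= j < size s) j.+1 * gaps s j)%N.
Proof.
elim: s => [|x s IHs] s_sorted; first by rewrite big_geq.
have s'_sorted := path_sorted s_sorted.
rewrite /= big_nat_recl //= mul1n (IHs s'_sorted).
have -> : (\sum_(0 <= j < size s) j.+2 * gaps (x :: s) j.+1 =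
           \sum_(0 <= j < size s) gaps s j + \sum_(0 <= j < size s) j.+1 * gaps s j)%N.
  by rewrite -big_split.
have := sum_gaps 0 s'_sorted; under eq_bigl do rewrite leq0n.
move=> ->; rewrite /gaps /= addnA; congr addn.
rewrite subnK //.
by case: s s_sorted {IHs s'_sorted} => //= y s /andP[].
Qed.

Lemma strict_partitionE (s : seq nat) :
  partD s = sorted gtn s && (0%N \notin s).
Proof. by rewrite /partD /= /is_partition gtn_sorted_uniq_geq andbAC [sorted _ _ && _]andbC. Qed.

Lemma gaps_gt0 (s : seq nat) (i : nat) : partD s -> (i < size s)%N ->
  (0 < gaps s i)%N.
Proof.
rewrite strict_partitionE => /andP[s_sorted s0] lt_i; rewrite subn_gt0.
case: (ltnP i.+1 (size s)) => [lt_i1|le_i].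
  by have/(sortedP 0%N)/(_ i lt_i1) := s_sorted.
rewrite [X in (X < _)%N]nth_default // lt0n; apply: contra s0 => /eqP <-.
exact: mem_nth.
Qed.

Definition of_gaps (k N : nat) (t : {ffun 'I_k -> 'I_N.+1}) : seq nat :=
  mkseq (fun i => \sum_(j < k | i <= j) t j)%N k.

Lemma gaps_of_gaps (k N : nat) (t : {ffun 'I_k -> 'I_N.+1}) (i : 'I_k) :
  gaps (of_gaps t) i = t i.
Proof.
have nthE j : nth 0%N (of_gaps t) j = (\sum_(l < k | j <= l) t l)%N.
  case: (ltnP j k) => [lt_j|le_j]; first by rewrite nth_mkseq.
  rewrite nth_default ?size_mkseq // big1 // => l.
  by rewrite leqNgt (leq_trans (ltn_ord l)).
rewrite /gaps !nthE (bigD1 i) //= [X in (_ + X - _)%N](_ : _ = \sum_(l < k | i < l) t l)%N.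
  by rewrite addnK.
by apply: eq_bigl => l; rewrite ltn_neqAle andbC eq_sym.
Qed.

Lemma of_gaps_partD (k N : nat) (t : {ffun 'I_k -> 'I_N.+1}) :
  [forall i, 0 < t i]%N -> partD (of_gaps t).
Proof.
move=> /forallP t_gt0; have gap_gt0 i : (i < k)%N -> (0 < gaps (of_gaps t) i)%N.
  by move=> lt_i; rewrite (gaps_of_gaps t (Ordinal lt_i)).
rewrite strict_partitionE; apply/andP; split.
  apply/(sortedP 0%N) => i; rewrite size_mkseq => lt_i.
  by have := gap_gt0 _ (ltnW lt_i); rewrite subn_gt0.
apply/negP => /(nthP 0%N)[i]; rewrite size_mkseq => /gap_gt0.
by rewrite /gaps => + i0; rewrite i0.
Qed.

(** Distinctness and positivity of the parts amount to positivity of all gaps, the last gap being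
    the last part. *)
Lemma sum_partD_gaps (V : nmodType) (N k n : nat)
    (F : {ffun 'I_k -> 'I_N.+1} -> V) : (n <= N)%N ->
  \sum_(s <- partitions n | partD s && (size s == k))
     F [ffun i : 'I_k => inord (gaps s i)]
  = \sum_(t : {ffun 'I_k -> 'I_N.+1} |
            [forall i, 0 < t i]%N && (\sum_(i < k) i.+1 * t i == n)%N) F t.
Proof.
move=> nN.
have gapsK s i : sumn s = n ->
    (inord (gaps s i) : 'I_N.+1) = gaps s i :> nat.
  move=> s_n; rewrite inordK // ltnS (leq_trans (leq_subr _ _)) //.
  case: (ltnP i (size s)) => [/(mem_nth 0%N)/leq_mem_sumn|le_i]; last by rewrite nth_default.
  by rewrite s_n => /leq_trans; apply.
have sortedD s : partD s -> sorted geq s by case/andP=> /andP[].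
apply: sum_partitions_reindex => [s|s t|t /andP[t_gt0 /eqP t_n]].
- case/and3P=> _ /eqP s_n /andP[sD /eqP s_k].
  apply/andP; split.
    by apply/forallP => i; rewrite ffunE gapsK // gaps_gt0 // s_k.
  rewrite -[X in _ == X]s_n sumn_gaps ?sortedD // s_k big_mkord.
  by apply/eqP; apply: eq_bigr => i _; rewrite ffunE gapsK.
- case/and3P=> _ /eqP s_n /andP[sD /eqP s_k].
  case/and3P=> _ /eqP t_n /andP[tD /eqP t_k] /ffunP eq_st.
  apply: (@eq_from_nth _ 0%N) => [|i _]; first by rewrite s_k.
  rewrite -!sum_gaps ?sortedD // s_k t_k big_nat_cond [RHS]big_nat_cond.
  apply: eq_bigr => j /andP[/andP[_ lt_j] _].
  by have := congr1 val (eq_st (Ordinal lt_j)); rewrite !ffunE /= !gapsK.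
- have tD := of_gaps_partD t_gt0.
  have sumE : sumn (of_gaps t) = n.
    rewrite sumn_gaps ?sortedD // size_mkseq big_mkord -t_n.
    by apply: eq_bigr => i _; rewrite gaps_of_gaps.
  exists (of_gaps t).
    by rewrite inE tD sumE size_mkseq !eqxx; case/andP: tD => ->.
  by apply/ffunP => i; apply/val_inj; rewrite ffunE /= gapsK // gaps_of_gaps.
Qed.

(** Sortedness makes the truncated subtraction in [gaps] exact. *)
Lemma omega2_tilde_gaps (s : seq nat) : sorted geq s ->
  omega2_tilde s = \prod_(i < size s) (2 * (gaps s i)%:Z - 1).
Proof.
move=> s_sorted; apply: eq_bigr => i _; rewrite -mulrBr subzn //.
have := sum_gaps i s_sorted; have := sum_gaps i.+1 s_sorted => <- <-.
rewrite big_mkcond [leqRHS]big_mkcond; apply: leq_sum => j _.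
by case: ltnP => [/ltnW ->|].
Qed.

(** * The weights and their generating functions *)

Lemma prod_ord_succ (R : pzSemiRingType) (M : nat) (F : nat -> R) :
  \prod_(i < M) F i.+1 = \prod_(1 <= n < M.+1) F n.
Proof. by rewrite big_add1 /= big_mkord. Qed.

Lemma expr2_count_undup (M : nat) (P : pred nat) (s : seq nat) :
  is_partition s -> (sumn s <= M)%N ->
  2 ^+ count P (undup s) =
  \prod_(1 <= n < M.+1) (if P n then 2 ^+ chi (1 <= freq n s)%N else 1) :> int.
Proof.
move=> /andP[_ s0] le_M.
rewrite -big_mkcond prodrXr -sum1_count -big_filter; congr (_ ^+ _).
transitivity (\sum_(1 <= n < M.+1 | P n && (1 <= freq n s)) 1)%N; last first.
  by rewrite big_mkcondr; apply: eq_bigr => n _; rewrite /chi; case: leqP.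
rewrite -[RHS]big_filter; apply: perm_big; apply: uniq_perm.
- by rewrite filter_uniq ?undup_uniq.
- by rewrite filter_uniq ?iota_uniq.
move=> n; rewrite !mem_filter mem_undup mem_index_iota -has_count has_pred1.
rewrite -andbA; congr (_ && _); rewrite andb_idr // => n_s.
rewrite ltnS (leq_trans (leq_mem_sumn n_s)) // andbT lt0n.
by apply: contraNneq s0 => <-.
Qed.

(* The factor at the part [n] in the [j]-th summand of [omega2_star].  With
[j = 0] this is the summand outside the sum: then [2j+1 = 1], which accounts
for [1 - chi (2 <= f_1)]. *)
Definition star_factor (j n f : nat) : int :=
  if (n < j)%N then (chi (3 <= f)%N)%:Z * 2 ^+ chi (4 <= f)%N
  else if n == j then (chi (2 <= f)%N)%:Z * 2 ^+ chi (3 <= f)%N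
  else if n == (2 * j + 1)%N then (chi (f <= 1)%N)%:Z
  else 2 ^+ chi (1 <= f)%N.

Lemma prod_freq_widen (M N m : nat) (P : pred nat) (s : seq nat) :
  (sumn s <= N)%N -> (N <= M)%N -> (m <= N.+1)%N ->
  \prod_(m <= n < N.+1 | P n) 2 ^+ chi (1 <= freq n s)%N
  = \prod_(m <= n < M.+1 | P n) 2 ^+ chi (1 <= freq n s)%N :> int.
Proof.
move=> sN NM mN; rewrite [RHS](big_cat_nat mN) //= [X in _ * X]big_nat_cond.
rewrite [X in _ * X]big1 ?mulr1 // => n /andP[/andP[lt_n _] _].
by rewrite freq_gt_sumn // (leq_ltn_trans sN).
Qed.

(** The bound [2 * N < M] keeps the part 2j+1 in range for every j <= N. *)
Lemma omega2_star_prod (M N : nat) (s : seq nat) :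
  (sumn s <= N)%N -> (2 * N < M)%N ->
  omega2_star s = \sum_(0 <= j < N.+1)
    \prod_(1 <= n < M.+1) star_factor j n (freq n s).
Proof.
move=> sN NM; rewrite -(omega2_star_uptoE sN) /omega2_star_upto.
rewrite [RHS]big_ltn //; congr (_ + _).
  rewrite [RHS]big_ltn ?ltnS; last by lia.
  congr (_ * _); first by rewrite /star_factor /= /chi; case: ltnP.
  (* For N = 0 the lower bound 2 is too large for [prod_freq_widen]. *)
  have [N0|N_gt0] := posnP N.
    rewrite N0 big_geq // big_nat big1 // => n /andP[n_gt1 _].
    rewrite /star_factor ltn0 muln0 add0n !gtn_eqF // ?(ltnW n_gt1) //.
    by rewrite freq_gt_sumn //; lia.
  rewrite (prod_freq_widen (M := M)) //; last by lia.
  apply: eq_big_nat => n /andP[n_gt1 _].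
  by rewrite /star_factor ltn0 muln0 add0n !gtn_eqF // ltnW.
apply: eq_big_nat => j /andP[j_gt0 j_le].
(* The product is cut into n < j, n = j, n = 2j+1 and the other n > j, the four cases of
   [star_factor]. *)
rewrite [RHS](big_cat_nat (n := j)) //=; last by lia.
rewrite [X in _ = _ * X]big_ltn; last by lia.
rewrite [X in _ = _ * (_ * X)](bigD1_seq (2 * j + 1)%N) ?iota_uniq /=; first last.
- by [].
- by rewrite mem_index_iota; lia.
rewrite {2 3}/star_factor ltnn eqxx.
have -> : (2 * j + 1 < j)%N = false by lia.
have -> : (2 * j + 1 == j)%N = false by lia.
rewrite eqxx (prod_freq_widen (M := M)) //; last by lia.
have -> : \prod_(1 <= i < j) star_factor j i (freq i s) = \prod_(1 <= i < j)
    ((chi (3 <= freq i s)%N)%:Z * 2 ^+ chi (4 <= freq i s)%N).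
  apply: eq_big_nat => i /andP[_ lt_i].
  by rewrite /star_factor lt_i.
have -> : \prod_(j.+1 <= i < M.+1 | i != (2 * j + 1)%N)
    star_factor j i (freq i s) = \prod_(j.+1 <= i < M.+1 | i != (2 * j + 1)%N)
    2 ^+ chi (1 <= freq i s)%N.
  rewrite big_nat_cond [RHS]big_nat_cond.
  apply: eq_bigr => i /andP[/andP[lt_i _] /negPf ne_i].
  by rewrite /star_factor ne_i ltnNge (ltnW lt_i) gtn_eqF.
by ring.
Qed.

Definition prime_factor0 (n f : nat) : int :=
  if odd n then 1 else 2 ^+ chi (1 <= f)%N.

(* For [c = 4i+3], the factor [chi (c in s)] and the [2] that the part [c]
contributes to [2 ^+ mu_o c s] are merged at [n = c]. *)
Definition prime_factor (c n f : nat) : int :=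
  if odd n && (n < c)%N then 1
  else if n == c then 2 * (chi (1 <= f)%N)%:Z else 2 ^+ chi (1 <= f)%N.

Lemma omega2_prime_prod (M N : nat) (s : seq nat) :
  is_partition s -> (sumn s <= N)%N -> (4 * N + 3 <= M)%N ->
  omega2_prime s = \prod_(1 <= n < M.+1) prime_factor0 n (freq n s)
    + \sum_(0 <= i < N.+1)
        \prod_(1 <= n < M.+1) prime_factor (4 * i + 3) n (freq n s).
Proof.
move=> s_part sN NM; have sM : (sumn s <= M)%N by lia.
rewrite -(omega2_prime_uptoE sN) /omega2_prime_upto mulrDr mulr1.
rewrite {1}/nu_de (expr2_count_undup _ s_part sM); congr (_ + _).
  by apply: eq_bigr => n _; rewrite /prime_factor0; case: (odd n).
rewrite mulr_sumr; apply: eq_big_nat => i /andP[_ lt_i].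
rewrite /nu_de /mu_o !(expr2_count_undup _ s_part sM).
have -> : (4 * i + 3 \in s)%N = (1 <= freq (4 * i + 3) s)%N.
  by rewrite -has_count has_pred1.
set c := (4 * i + 3)%N; have c_odd : odd c by rewrite /c; lia.
have c_range : c \in index_iota 1 M.+1 by rewrite mem_index_iota /c; lia.
rewrite mulrCA -big_split /= (bigD1_seq c) ?iota_uniq //=.
rewrite [RHS](bigD1_seq c) ?iota_uniq //= mulrA; congr (_ * _).
  rewrite /prime_factor c_odd ltnn eqxx leqnn /=.
  by rewrite mul1r; case: (1 <= _)%N.
apply: eq_bigr => n /negPf ne_n; rewrite /prime_factor ne_n.
by case: (odd n); rewrite /= ?mul1r ?mulr1 // leqNgt; case: (n < c)%N.
Qed.

(** * From sums over partitions to products of local series *)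

Section GeneratingFunctions.
Variables (R : comNzRingType) (N : nat) (q : R).
Hypothesis q_nil : q ^+ N.+1 = 0.

Definition trunc_gf (W : fps) : R := \sum_(0 <= n < N.+1) (W n)%:~R * q ^+ n.

Definition partition_gf (w : seq nat -> R) : R :=
  \sum_(0 <= n < N.+1) (\sum_(s <- partitions n) w s) * q ^+ n.

Lemma eq_partition_gf (w w' : seq nat -> R) :
  (forall s, is_partition s -> (sumn s <= N)%N -> w s = w' s) ->
  partition_gf w = partition_gf w'.
Proof.
move=> ww'; apply: eq_big_nat => n /andP[_ le_n]; congr (_ * _).
rewrite big_seq [RHS]big_seq; apply: eq_bigr => s.
by rewrite mem_partitions => /andP[s_part /eqP s_n]; rewrite ww' ?s_n.
Qed.

Lemma partition_gfD (w w' : seq nat -> R) :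
  partition_gf (fun s => w s + w' s) = partition_gf w + partition_gf w'.
Proof.
rewrite /partition_gf -big_split; apply: eq_bigr => n _ /=.
by rewrite big_split mulrDl.
Qed.

Lemma partition_gf_sum (I : Type) (r : seq I) (w : I -> seq nat -> R) :
  partition_gf (fun s => \sum_(j <- r) w j s)
  = \sum_(j <- r) partition_gf (w j).
Proof.
rewrite /partition_gf exchange_big; apply: eq_bigr => n _ /=.
by rewrite exchange_big mulr_suml.
Qed.

Lemma trunc_gfU (w : seq nat -> int) :
  trunc_gf (weighted_gf partU w) = partition_gf (fun s => (w s)%:~R).
Proof.
apply: eq_bigr => n _; congr (_ * _); rewrite /weighted_gf rmorph_sum /=.
rewrite big_seq_cond [RHS]big_seq; apply: eq_bigl => s.
by rewrite mem_partitions /partU andbC andbA andbb.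
Qed.

(** Objects of weight above [N] carry a zero power of [q], so the constraint on the weight
    disappears. *)
Lemma sum_by_weight (T : finType) (Q : pred T) (wt : T -> nat) (F : T -> R) :
  \sum_(0 <= n < N.+1) (\sum_(t | Q t && (wt t == n)) F t) * q ^+ n
  = \sum_(t | Q t) F t * q ^+ wt t.
Proof.
under eq_bigr do rewrite mulr_suml.
rewrite (exchange_big_dep Q) /=; last by move=> n t _ /andP[].
apply: eq_bigr => t ->; case: (ltnP (wt t) N.+1) => [lt_t|le_t].
  rewrite -big_filter (perm_big [:: wt t]) ?big_seq1 //.
  apply: uniq_perm => [||n]; [exact: filter_uniq (iota_uniq 0 N.+1) | by [] |].
  rewrite mem_filter mem_index_iota inE /= eq_sym; case: eqP => // ->.
  by rewrite lt_t.
rewrite (qX_eq0 q_nil) // mulr0 big_nat_cond big1 // => n.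
by rewrite ltnNge; case: eqP => [<-|]; rewrite ?le_t ?andbF.
Qed.

(** Euler product: expanding the right side chooses a multiplicity for each part size. *)
Lemma partition_gf_prod (M : nat) (g : nat -> nat -> R) : (N <= M)%N ->
  partition_gf (fun s => \prod_(1 <= n < M.+1) g n (freq n s))
  = \prod_(1 <= n < M.+1) \sum_(0 <= k < N.+1) g n k * (q ^+ n) ^+ k.
Proof.
move=> NM; rewrite -[RHS]prod_ord_succ.
under [RHS]eq_bigr do rewrite big_mkord.
rewrite bigA_distr_bigA /=.
pose F (t : {ffun 'I_M -> 'I_N.+1}) := \prod_(i < M) g i.+1 (t i).
pose wt (t : {ffun 'I_M -> 'I_N.+1}) := (\sum_(i < M) i.+1 * t i)%N.
transitivity (\sum_(t : {ffun 'I_M -> 'I_N.+1}) F t * q ^+ wt t); last first.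
  apply: eq_bigr => t _; rewrite /F /wt -prodrXr -big_split.
  by apply: eq_bigr => i _; rewrite exprM.
rewrite -(sum_by_weight xpredT wt F); apply: eq_big_nat => n /andP[_ lt_n].
rewrite -(sum_partitions_freq F _ NM) //; congr (_ * _).
rewrite big_seq [RHS]big_seq; apply: eq_bigr => s.
rewrite mem_partitions => /andP[_ /eqP s_n].
rewrite -prod_ord_succ; apply: eq_bigr => i _; rewrite ffunE inordK //.
by rewrite ltnS (leq_trans (leq_freq_sumn _ _)) // s_n.
Qed.

(** For a fixed number k of parts, the k gaps vary independently over the positive integers. *)
Lemma trunc_gf_tilde_gaps :
  trunc_gf (weighted_gf partD omega2_tilde)
  = \sum_(0 <= k < N.+1) \prod_(1 <= n < k.+1)
      \sum_(0 <= d < N.+1) ((0 < d)%N * (2 * d - 1))%:R * (q ^+ n) ^+ d.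
Proof.
transitivity (\sum_(0 <= n < N.+1) \sum_(0 <= k < N.+1)
  (\sum_(s <- partitions n | partD s && (size s == k)) (omega2_tilde s)%:~R)
  * q ^+ n : R).
  apply: eq_big_nat => n /andP[_ lt_n]; rewrite -mulr_suml; congr (_ * _).
  rewrite /weighted_gf rmorph_sum /= big_mkord.
  rewrite big_seq_cond (partition_big (fun s => inord (size s) : 'I_N.+1) xpredT) //=.
  apply: eq_bigr => k _; rewrite [RHS]big_seq_cond; apply: eq_bigl => s.
  case: (boolP (s \in partitions n)) => //.
  rewrite mem_partitions => /andP[/andP[_ /leq_size_sumn sz_s] /eqP s_n].
  congr (_ && _); rewrite -val_eqE /= inordK // ltnS (leq_trans sz_s) // s_n.
  exact: lt_n.
rewrite exchange_big; apply: eq_bigr => k _ /=.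
rewrite -prod_ord_succ; under [RHS]eq_bigr do rewrite big_mkord.
rewrite bigA_distr_bigA /=.
pose F (t : {ffun 'I_k -> 'I_N.+1}) : R := \prod_(i < k) (2 * (t i)%:R - 1).
pose Q (t : {ffun 'I_k -> 'I_N.+1}) := [forall i, 0 < t i]%N.
pose wt (t : {ffun 'I_k -> 'I_N.+1}) := (\sum_(i < k) i.+1 * t i)%N.
transitivity (\sum_(t | Q t) F t * q ^+ wt t).
  rewrite -(sum_by_weight Q wt F); apply: eq_big_nat => n /andP[_ lt_n].
  rewrite -(sum_partD_gaps F) //; congr (_ * _).
  rewrite big_seq_cond [RHS]big_seq_cond; apply: eq_bigr => s.
  rewrite mem_partitions => /and3P[/andP[_ /eqP s_n] sD /eqP s_k].
  rewrite omega2_tilde_gaps; last by case/andP: sD => /andP[].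
  rewrite rmorph_prod /= s_k; apply: eq_bigr => i _; rewrite ffunE inordK.
    by rewrite rmorphB rmorphM /= !rmorph1 -!pmulrn.
  rewrite ltnS (leq_trans (leq_subr _ _)) // (leq_trans _ (_ : n <= N)%N) //.
  by rewrite -s_n leq_mem_sumn // mem_nth // s_k.
(* The indicator of 0 < d kills every vector with a zero gap. *)
rewrite [RHS](bigID Q) /= [X in _ = _ + X]big1 ?addr0 => [|t].
  apply: eq_bigr => t /forallP t_gt0; rewrite /F /wt -prodrXr -big_split.
  apply: eq_bigr => i _ /=; rewrite exprM t_gt0 mul1n natrB ?natrM //.
  by have := t_gt0 i; lia.
rewrite negb_forall => /existsP[i]; rewrite -leqNgt leqn0 => /eqP t0.
by rewrite (bigD1 i) //= t0 !mul0r.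
Qed.

End GeneratingFunctions.

Lemma triE (n : nat) : tri n = (\sum_(1 <= i < n.+1) i)%N.
Proof.
elim: n => [|n IHn]; first by rewrite big_geq.
by rewrite triS IHn [RHS]big_nat_recr.
Qed.

Lemma prod_odd (R : comPzSemiRingType) (m : nat) (F : nat -> R) :
  \prod_(1 <= n < m.*2.+1) (if odd n then F n else 1) = \prod_(i < m) F i.*2.+1.
Proof.
elim: m => [|m IHm]; first by rewrite big_geq ?big_ord0.
rewrite doubleS 2?big_nat_recr //= IHm big_ord_recr /= odd_double /=.
by rewrite mulr1.
Qed.

(** * Local series and evaluation of the three generating functions *)

Section Products.
Variables (R : comNzRingType) (N : nat) (q : R).
Hypothesis q_nil : q ^+ N.+1 = 0.

Lemma sum_geX (a : nat) (x : R) : x ^+ N.+1 = 0 ->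
  \sum_(0 <= k < N.+1) (a <= k)%N%:R * x ^+ k = x ^+ a * geo N x.
Proof.
move=> x0; have E : (1 - x) * \sum_(0 <= k < N.+1) (a <= k)%N%:R * x ^+ k = x ^+ a.
  (* The certificate x^max(a,k) is constant up to k = a and geometric from there on. *)
  rewrite mulr_sumr (@sumr_telescope _ _ (fun k => x ^+ maxn a k)) => [|k].
    by rewrite maxn0 (qX_eq0 x0 (m := maxn _ _)) ?subr0 // leq_maxr.
  case: (leqP a k) => [le_k|lt_k].
    by rewrite !(maxn_idPr _) ?(leqW le_k) // exprS /= mulr1n; ring.
  by rewrite !(maxn_idPl _) ?(ltnW lt_k) // subrr /= mulr0n; ring.
by rewrite -E mulrAC geoV ?mul1r.
Qed.

(** The weight, equal to 0, 1, 2 for k < a, k = a, k > a, is a sum of two indicators. *)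
Lemma sum_ge_expr2 (a : nat) (x : R) : x ^+ N.+1 = 0 ->
  \sum_(0 <= k < N.+1)
     ((chi (a <= k)%N)%:Z * 2 ^+ chi (a < k)%N)%:~R * x ^+ k
  = x ^+ a * ((1 + x) * geo N x).
Proof.
move=> x0; have -> : x ^+ a * ((1 + x) * geo N x) = \sum_(0 <= k < N.+1)
    ((a <= k)%N%:R * x ^+ k + (a < k)%N%:R * x ^+ k).
  by rewrite big_split /= !sum_geX // exprS; ring.
apply: eq_bigr => k _; rewrite -mulrDl; congr (_ * _); rewrite /chi.
case: (ltnP a k) => [lt_k|_]; first by rewrite (ltnW lt_k).
by rewrite mulr1 addr0 -pmulrn.
Qed.

Lemma sum_expr2 (x : R) : x ^+ N.+1 = 0 ->
  \sum_(0 <= k < N.+1) (2 ^+ chi (1 <= k)%N)%:~R * x ^+ k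
  = (1 + x) * geo N x.
Proof.
move=> x0; rewrite -[RHS]mul1r -(expr0 x) -sum_ge_expr2 //.
by apply: eq_bigr => k _; rewrite mul1r.
Qed.

(** The coefficients 0, 1, 3, 5, ... have first differences 0, 1, 2, 2, ..., again a sum of two
    indicators. *)
Lemma sum_gapX (x : R) : x ^+ N.+1 = 0 ->
  \sum_(0 <= d < N.+1) ((0 < d)%N * (2 * d - 1))%:R * x ^+ d
  = x * (1 + x) * geo N x * geo N x.
Proof.
move=> x0; set S := LHS.
pose c d : R := ((0 < d)%N * (2 * d - 1))%:R.
have E : (1 - x) * S = x * (1 + x) * geo N x.
  have -> : x * (1 + x) * geo N x =
      \sum_(0 <= k < N.+1) ((1 <= k)%N%:R * x ^+ k + (2 <= k)%N%:R * x ^+ k).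
    by rewrite big_split /= !sum_geX // expr1; ring.
  apply/subr0_eq; rewrite mulr_sumr -sumrB.
  (* At d = 0 the predecessor is 0 and [c 0 = 0], so the initial value vanishes. *)
  rewrite (@sumr_telescope _ _ (fun d => c d.-1 * x ^+ d)) => [|d].
    by rewrite x0 mulr0 subr0 mul0r.
  rewrite -/(c d) exprS /=; case: d => [|d] /=; first by rewrite /c; ring.
  have -> : c d.+1 = c d + 1 + (1 < d.+1)%N%:R.
    by rewrite /c -[X in _ + X + _]/(1%:R) -!natrD; congr _%:R; case: d => //= d; lia.
  by ring.
by rewrite -E mulrAC geoV // mul1r.
Qed.

Local Notation theta :=
  (\sum_(0 <= r < N.+1) q ^+ (r * r + tri r) * (1 - q ^+ r.*2.+1)).

Lemma trunc_gf_tilde :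
  trunc_gf N q (weighted_gf partD omega2_tilde)
  = qpochp q N * qpochV N q N * theta.
Proof.
rewrite trunc_gf_tilde_gaps // -bailey_theta //; apply: eq_bigr => k _.
rewrite triE -prodrXr /qpochp /qpochV.
rewrite (prod_ord_succ _ (fun n => 1 + q ^+ n)) (prod_ord_succ _ (fun n => geo N (q ^+ n))).
rewrite -!big_split /=; apply: eq_big_nat => n /andP[n_gt0 _].
by rewrite sum_gapX // (qXX_eq0 q_nil).
Qed.

(** Extracts the common factor (-q)_oo / (q)_oo of the sums over all partitions. *)
Lemma prod_excess (M : nat) (e : nat -> R) : (N <= M)%N ->
  \prod_(1 <= n < M.+1) (e n * ((1 + q ^+ n) * geo N (q ^+ n)))
  = qpochp q N * qpochV N q N * \prod_(1 <= n < M.+1) e n.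
Proof.
move=> NM; rewrite !big_split /= mulrC; congr (_ * _ * _).
  by rewrite -prod_ord_succ -/(qpochp q M) (qpochpE q_nil NM).
by rewrite -(prod_ord_succ _ (fun n => geo N (q ^+ n))) -/(qpochV N q M) (qpochVE q_nil NM).
Qed.

(* The ratio of the local generating function at the part [n] to
[(1 + q^n) / (1 - q^n)], the one of [2 ^+ chi (1 <= f_n)]. *)
Definition star_excess (j n : nat) : R :=
  if (n < j)%N then q ^+ (3 * n) else if n == j then q ^+ (2 * n)
  else if n == j.*2.+1 then 1 - q ^+ n else 1.

Lemma sum_star_factor (j n : nat) : (0 < n)%N ->
  \sum_(0 <= k < N.+1) (star_factor j n k)%:~R * (q ^+ n) ^+ k
  = star_excess j n * ((1 + q ^+ n) * geo N (q ^+ n)).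
Proof.
move=> n_gt0; have x0 : (q ^+ n) ^+ N.+1 = 0 by rewrite (qXX_eq0 q_nil).
rewrite /star_excess /star_factor; case: (ltnP n j) => [_|_].
  by rewrite sum_ge_expr2 // -exprM mulnC.
case: eqP => [_|_]; first by rewrite sum_ge_expr2 // -exprM mulnC.
rewrite mul2n addn1; case: eqP => [_|_]; last by rewrite sum_expr2 // mul1r.
(* The indicator of k <= 1 is 1 minus that of 2 <= k, giving (1 - x^2) / (1 - x) with x = q^n. *)
transitivity (\sum_(0 <= k < N.+1)
    ((0 <= k)%N%:R * (q ^+ n) ^+ k - (2 <= k)%N%:R * (q ^+ n) ^+ k)).
  apply: eq_bigr => k _; rewrite -mulrBl; congr (_ * _).
  by rewrite /chi; case: (leqP k 1); rewrite ?subr0 ?subrr.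
by rewrite sumrB !sum_geX // expr0; ring.
Qed.

(** The exponent is 3 (1 + ... + (j-1)) + 2j = j(3j+1)/2. *)
Lemma prod_star_excess (M j : nat) : (2 * j < M)%N ->
  \prod_(1 <= n < M.+1) star_excess j n
  = q ^+ (j * j + tri j) * (1 - q ^+ j.*2.+1).
Proof.
move=> lt_j.
pose a n := if (n < j.+1)%N then q ^+ (if (n < j)%N then 3 * n else 2 * n) else 1.
transitivity (\prod_(1 <= n < M.+1)
    (a n * (if n == j.*2.+1 then 1 - q ^+ n else 1))).
  apply: eq_bigr => n _; rewrite /star_excess /a ltnS.
  case: ltngtP => [lt_n|gt_n|->]; rewrite ?mul1r //.
    by rewrite ifF ?mulr1 //; apply/eqP; lia.
  by rewrite ifF ?mulr1 //; apply/eqP; lia.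
rewrite big_split; congr (_ * _); last first.
  rewrite (bigD1_seq j.*2.+1) ?iota_uniq //= ?mem_index_iota; last by lia.
  by rewrite eqxx big1 ?mulr1 // => n /negPf->.
rewrite (big_cat_nat (n := j.+1)) //=; last by lia.
rewrite [X in _ * X]big_nat [X in _ * X]big1 ?mulr1 => [|n /andP[le_n _]].
  rewrite big_nat.
  transitivity (\prod_(1 <= n < j.+1) q ^+ (if (n < j)%N then 3 * n else 2 * n)).
    by rewrite [RHS]big_nat; apply: eq_bigr => n /andP[_ lt_n]; rewrite /a lt_n.
  rewrite prodrXr; congr (_ ^+ _).
  case: j lt_j {a} => [|j] lt_j; first by rewrite big_geq.
  rewrite big_nat_recr //= ltnn.
  have -> : (\sum_(1 <= i < j.+1) (if i < j.+1 then 3 * i else 2 * i) = 3 * tri j)%N.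
    by rewrite triE big_distrr; apply: eq_big_nat => i /andP[_ ->].
  by rewrite triS; have := tri_double j; lia.
by rewrite /a ltnNge le_n.
Qed.

Lemma trunc_gf_star :
  trunc_gf N q (weighted_gf partU omega2_star)
  = qpochp q N * qpochV N q N * theta.
Proof.
have NM : (N <= (2 * N).+1)%N by lia.
rewrite trunc_gfU.
transitivity (partition_gf N q (fun s => \sum_(0 <= j < N.+1)
    \prod_(1 <= n < (2 * N).+2) (star_factor j n (freq n s))%:~R)).
  apply: eq_partition_gf => s _ sN; rewrite (omega2_star_prod sN (leqnn _)).
  by rewrite rmorph_sum; apply: eq_bigr => j _; rewrite rmorph_prod.
rewrite partition_gf_sum mulr_sumr; apply: eq_big_nat => j /andP[_ lt_j].
rewrite (partition_gf_prod q_nil (fun n f => (star_factor j n f)%:~R) NM).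
rewrite -(prod_star_excess (M := (2 * N).+1)) -?prod_excess //; last by lia.
by apply: eq_big_nat => n /andP[n_gt0 _]; apply: sum_star_factor.
Qed.

(** Ratios to (1 + q^n) / (1 - q^n), as in [star_excess]: an odd part of constant weight 1 has
    series 1 / (1 - q^n), hence ratio 1 / (1 + q^n); the part [c] below has series 2 q^n / (1 -
    q^n). *)
Definition prime_excess0 (n : nat) : R := if odd n then geo N (- q ^+ n) else 1.

Definition prime_excess (c n : nat) : R :=
  (if n == c then 2 * q ^+ n else 1)
  * (if odd n && (n <= c)%N then geo N (- q ^+ n) else 1).

Lemma sum_prime_factor0 (n : nat) : (0 < n)%N ->
  \sum_(0 <= k < N.+1) (prime_factor0 n k)%:~R * (q ^+ n) ^+ k
  = prime_excess0 n * ((1 + q ^+ n) * geo N (q ^+ n)).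
Proof.
move=> n_gt0; have x0 : (q ^+ n) ^+ N.+1 = 0 by rewrite (qXX_eq0 q_nil).
rewrite /prime_factor0 /prime_excess0; case: (odd n); last first.
  by rewrite sum_expr2 // mul1r.
rewrite mulrA [geo _ _ * _]mulrC (geoqpV q_nil) // mul1r.
by apply: eq_bigr => k _; rewrite mul1r.
Qed.

Lemma sum_prime_factor (c n : nat) : odd c -> (0 < n)%N ->
  \sum_(0 <= k < N.+1) (prime_factor c n k)%:~R * (q ^+ n) ^+ k
  = prime_excess c n * ((1 + q ^+ n) * geo N (q ^+ n)).
Proof.
move=> c_odd n_gt0; have x0 : (q ^+ n) ^+ N.+1 = 0 by rewrite (qXX_eq0 q_nil).
have geoK : geo N (- q ^+ n) * ((1 + q ^+ n) * geo N (q ^+ n)) = geo N (q ^+ n).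
  by rewrite mulrA [geo _ _ * _]mulrC (geoqpV q_nil) // mul1r.
rewrite /prime_factor /prime_excess (leq_eqVlt n).
case: (eqVneq n c) => [n_c|_] /=.
  subst c; rewrite ltnn andbF c_odd /= -!mulrA geoK -[q ^+ n]expr1 -sum_geX //.
  by rewrite mulr_sumr; apply: eq_bigr => k _; rewrite rmorphM /= -pmulrn mulrA.
rewrite mul1r; case: ifP => _; last by rewrite sum_expr2 // mul1r.
by rewrite geoK; apply: eq_bigr => k _; rewrite mul1r.
Qed.

Lemma prod_prime_excess0 :
  \prod_(1 <= n < (4 * N + 4).+1) prime_excess0 n = qpochoV N q N.
Proof.
have -> : (4 * N + 4 = (N.*2.+2).*2)%N by lia.
by rewrite prod_odd -/(qpochoV N q _) (qpochoVE q_nil) //; lia.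
Qed.

Lemma prod_prime_excess (i : nat) : (i <= N)%N ->
  \prod_(1 <= n < (4 * N + 4).+1) prime_excess (4 * i + 3) n
  = 2 * q ^+ (4 * i + 3) * qpochoV N q i.*2.+2.
Proof.
move=> le_i; rewrite big_split; congr (_ * _).
  rewrite (bigD1_seq (4 * i + 3)%N) ?iota_uniq //= ?mem_index_iota; last by lia.
  by rewrite eqxx big1 ?mulr1 // => n /negPf->.
rewrite (big_cat_nat (n := (i.*2.+2).*2.+1)) //=; last by lia.
rewrite [X in _ * X]big_nat [X in _ * X]big1 ?mulr1 => [|n /andP[le_n _]].
  rewrite /qpochoV -(prod_odd _ (fun n => geo N (- q ^+ n))).
  apply: eq_big_nat => n /andP[_ lt_n].
  case: (boolP (odd n)) => //= n_odd; rewrite ifT //; lia.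
by rewrite ifF //; lia.
Qed.

Lemma trunc_gf_prime :
  trunc_gf N q (weighted_gf partU omega2_prime)
  = qpochp q N * qpochV N q N * theta.
Proof.
(* The bound 4N+4 covers 4i+3 for all i <= N and is even, as [prod_odd] requires. *)
have NM : (N <= 4 * N + 4)%N by lia.
rewrite trunc_gfU theta_odd // mulrDr -prod_prime_excess0 -prod_excess // mulr_sumr.
transitivity (partition_gf N q (fun s =>
    \prod_(1 <= n < (4 * N + 4).+1) (prime_factor0 n (freq n s))%:~R
    + \sum_(0 <= i < N.+1) \prod_(1 <= n < (4 * N + 4).+1)
        (prime_factor (4 * i + 3) n (freq n s))%:~R)).
  apply: eq_partition_gf => s s_part sN.
  rewrite (@omega2_prime_prod (4 * N + 4) N) //; last by lia.
  rewrite rmorphD rmorph_prod rmorph_sum; congr (_ + _).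
  by apply: eq_bigr => j _; rewrite rmorph_prod.
rewrite partition_gfD partition_gf_sum; congr (_ + _).
  rewrite (partition_gf_prod q_nil (fun n f => (prime_factor0 n f)%:~R) NM).
  by apply: eq_big_nat => n /andP[n_gt0 _]; apply: sum_prime_factor0.
apply: eq_big_nat => i /andP[_ lt_i].
rewrite (partition_gf_prod q_nil (fun n f => (prime_factor (4 * i + 3) n f)%:~R) NM).
rewrite -prod_prime_excess // -prod_excess //.
apply: eq_big_nat => n /andP[n_gt0 _]; apply: sum_prime_factor => //.
by rewrite oddD oddM.
Qed.

End Products.

(** * Coefficient extraction in Z[X]/(X^(N+1)) *)

(** The truncated series is the class of a polynomial of degree at most [N], which is its own
    reduced representative, so its coefficients can be read off. *)
Lemma trunc_gf_inj (N : nat) (V W : fps) (h := 'X ^+ N.+1 : {poly int}) :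
  trunc_gf N 'qX V = trunc_gf N 'qX W :> {poly %/ h} -> V N = W N.
Proof.
have monic_h : mk_monic h = h by rewrite /mk_monic size_polyXn monicXn.
have coefN U : (polyn (trunc_gf N 'qX U : {poly %/ h}))`_N = U N.
  pose p := \poly_(i < N.+1) U i.
  have -> : trunc_gf N 'qX U = in_qpoly h p.
    rewrite /p poly_def rmorph_sum /trunc_gf big_mkord; apply: eq_bigr => i _.
    by rewrite /= in_qpolyZ rmorphXn /= -[in RHS](intz (U i)) scaler_int mulrzl.
  rewrite in_qpoly_small ?coef_poly ?ltnSn // monic_h size_polyXn ltnS.
  exact: size_poly.
by move=> eqVW; rewrite -(coefN V) -(coefN W) eqVW.
Qed.

Lemma qX_nil (N : nat) : ('qX : {poly %/ ('X ^+ N.+1 : {poly int})}) ^+ N.+1 = 0.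
Proof.
rewrite -rmorphXn; apply/val_inj => /=.
rewrite /mk_monic size_polyXn monicXn /= Pdiv.CommonRing.rmodpp //.
exact: mulrC.
Qed.

Theorem theorem4p4 :
  weighted_gf partD omega2_tilde =1 weighted_gf partU omega2_prime /\
  weighted_gf partU omega2_prime =1 weighted_gf partU omega2_star.
Proof.
(* Coefficient [N] is compared modulo X^(N+1), where all three series equal (-q)_oo / (q)_oo times
   theta. *)
split=> N; apply: trunc_gf_inj; rewrite trunc_gf_prime ?qX_nil //.
  by rewrite trunc_gf_tilde ?qX_nil.
by rewrite trunc_gf_star ?qX_nil.
Qed.
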